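(* Let $\Omega$ be a countably infinite set, let $\gamma_{i\to j}\ge 0$ ($i,j\in\Omega$, $\gamma_{i\to i}=0$) be transition rates, and let $\Gamma$ be the associated generator. Assume $\|\Gamma\|_{1,1}:=\sum_{i,j\in\Omega}|\Gamma^{(i,j)}|<\infty$. Let $P_0$ be a probability vector on $\Omega$ and let $t>0$. Then the solution $P(t\mid P_0)=e^{t\Gamma}P_0$ of the master equation $\dot P=\Gamma P$, $P(0)=P_0$, is approximated by the solutions on finite subsystems in the thermodynamic limit: $$\lim_{|F|\to\infty}P^{F}\bigl(t\mid P_0^{[F]}\bigr)=P(t\mid P_0)\quad\text{in }\|\cdot\|_1,$$ i.e. for every $\epsilon>0$ there is a finite set $F_\epsilon\subseteq\Omega$ such that for every finite $F\subseteq \Omega$ with $F\supseteq F_\epsilon$ one has $P_0(F)>0$ and $\bigl\|P(t\mid P_0)-P^F(t\mid P_0^{[F]})\bigr\|_1<\epsilon$.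
   Context: $\ell^1(\Omega)$ is the space of real absolutely summable families $X=(X^{(\omega)})_{\omega\in\Omega}$ with norm $\|X\|_1=\sum_\omega|X^{(\omega)}|$. A probability vector is $P\in[0,\infty)^\Omega$ with $\|P\|_1=1$; for $A\subseteq\Omega$, $P(A)=\sum_{a\in A}P^{(a)}$. Generator: $\Gamma^{(i,j)}=\gamma_{j\to i}$ for $i\ne j$ and $\Gamma^{(j,j)}=-\sum_{k\in\Omega}\gamma_{j\to k}$. For a finite set $F\subseteq\Omega$, the generator $\Gamma^{[F]}$ of the finite subsystem (an $\Omega\times\Omega$ matrix) is: $(\Gamma^{[F]})^{(i,j)}=\gamma_{j\to i}$ if $i\neq j$, $i,j\in F$; $(\Gamma^{[F]})^{(j,j)}=-\sum_{f\in F}\gamma_{j\to f}$ if $j\in F$; and all other entries are $0$. For a probability vector $P_0$ and a finite $F$ with $P_0(F)>0$, $P_0^{[F]}$ is the probability vector with entries $P_0^{(i)}/P_0(F)$ for $i\in F$ and $0$ for $i\notin F$. The solution on the finite subsystem is $P^F(t\mid P_0^{[F]}):=e^{t\Gamma^{[F]}}P_0^{[F]}$. *)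

(* Defs.v *)
From HB Require Import structures.
From mathcomp Require Import all_boot all_order all_algebra finmap.
From mathcomp Require Import mathcomp_extra boolp classical_sets functions.
From mathcomp Require Import cardinality reals ereal topology normedtype.
From mathcomp Require Import sequences numfun esum.

Set Implicit Arguments.
Unset Strict Implicit.
Unset Printing Implicit Defensive.

Import Order.TTheory GRing.Theory Num.Theory.
Import numFieldNormedType.Exports.

Local Open Scope classical_set_scope.
Local Open Scope ring_scope.

(* Vectors are all functions [Omega -> R]; the space l^1(Omega) consists of
   those with finite [l1norm].  An Omega x Omega matrix is a function
   [A : Omega -> Omega -> R] with [A i j] in row [i] and column [j]. *)

(* The sum of an absolutely summable real family.  [\esum] is only a sum for
   nonnegative families, hence the split into positive and negative parts. *)
Definition rsum (R : realType) (Omega : choiceType) (f : Omega -> R) : R :=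
  fine (\esum_(w in [set: Omega]) (EFin \o f)^\+ w -
        \esum_(w in [set: Omega]) (EFin \o f)^\- w)%E.

Definition l1norm (R : realType) (Omega : choiceType) (X : Omega -> R) : \bar R :=
  (\esum_(w in [set: Omega]) `|X w|%:E)%E.

Definition norm11 (R : realType) (Omega : choiceType) (A : Omega -> Omega -> R)
    : \bar R :=
  (\esum_(ij in [set: Omega * Omega]) `|A ij.1 ij.2|%:E)%E.

Definition probability_vector (R : realType) (Omega : choiceType)
    (P : Omega -> R) : Prop :=
  (forall w, 0 <= P w) /\ l1norm P = 1%E.

Definition mulmxv (R : realType) (Omega : choiceType)
    (A : Omega -> Omega -> R) (X : Omega -> R) : Omega -> R :=
  fun i => rsum (fun j => A i j * X j).

(* The limit in l^1 norm of a sequence of vectors, if it exists; such a limit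
   is unique.  Arbitrary value otherwise. *)
Definition l1lim (R : realType) (Omega : choiceType) (X : nat -> Omega -> R)
    : Omega -> R :=
  get [set Y : Omega -> R | l1norm (X n \- Y) @[n --> \oo] --> (0 : \bar R)%E].

(* e^A X, as the l^1 limit of the partial sums of the exponential series
   \sum_k A^k X / k!. *)
Definition expmxv (R : realType) (Omega : choiceType)
    (A : Omega -> Omega -> R) (X : Omega -> R) : Omega -> R :=
  l1lim (fun n w => \sum_(0 <= k < n) (k`!%:R)^-1 * iter k (mulmxv A) X w).

(* In the following, [gamma j i] is the rate of the transition j -> i. *)

(* If the total exit rate of some [j] is infinite, [fine] sets the diagonal
   entry to 0, but then [norm11 (generator gamma)] is already infinite because
   of the other entries of column [j]. *)
Definition generator (R : realType) (Omega : choiceType)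
    (gamma : Omega -> Omega -> R) : Omega -> Omega -> R :=
  fun i j =>
    if i == j then - fine (\esum_(k in [set: Omega]) (gamma j k)%:E)%E
    else gamma j i.

Definition generator_on (R : realType) (Omega : choiceType)
    (gamma : Omega -> Omega -> R) (F : {fset Omega}) : Omega -> Omega -> R :=
  fun i j =>
    if (i \in F) && (j \in F) then
      if i == j then - \sum_(f <- F) gamma j f else gamma j i
    else 0.

Definition weight (R : realType) (Omega : choiceType) (P : Omega -> R)
    (F : {fset Omega}) : R :=
  \sum_(a <- F) P a.

Definition restrict_vector (R : realType) (Omega : choiceType) (P : Omega -> R)
    (F : {fset Omega}) : Omega -> R :=
  fun i => if i \in F then P i / weight P F else 0.

Definition solution (R : realType) (Omega : choiceType)
    (gamma : Omega -> Omega -> R) (t : R) (P0 : Omega -> R) : Omega -> R :=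
  expmxv (fun i j => t * generator gamma i j) P0.

(* Unlike for [solution], the initial vector is restricted to [F] here:
   e^(t Gamma^[F]) P0^[F]. *)
Definition solution_on (R : realType) (Omega : choiceType)
    (gamma : Omega -> Omega -> R) (F : {fset Omega}) (t : R) (P0 : Omega -> R)
    : Omega -> R :=
  expmxv (fun i j => t * generator_on gamma F i j) (restrict_vector P0 F).

(* Main.v *)
(* An l^1 operator all of whose columns have norm at most c is bounded by c, so
   telescoping gives, for two such operators A, B with c >= 1,
     |A^k X - B^k Z| <= (2c)^k (|A - B| |X| + |X - Z|),
   and summing against 1/k!,
     |e^A X - e^B Z| <= e^(2c) (|A - B| |X| + |X - Z|).
   The columns of Gamma^[F] are dominated by those of Gamma.  The columns of
   Gamma - Gamma^[F] are at most twice the mass of Gamma outside F x F, once for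
   the entries outside F x F and once for the exit rates missing on the diagonal;
   |P0 - P0^[F]| is at most twice the mass of P0 outside F.  Both masses are tails
   of convergent sums. *)

Require Import Defs.
From HB Require Import structures.
From mathcomp Require Import all_boot all_order all_algebra finmap.
From mathcomp Require Import mathcomp_extra boolp classical_sets functions fsbigop.
From mathcomp Require Import cardinality reals ereal topology normedtype.
From mathcomp Require Import sequences numfun esum ring lra.

Set Implicit Arguments.
Unset Strict Implicit.
Unset Printing Implicit Defensive.

Import Order.TTheory GRing.Theory Num.Theory.
Import numFieldNormedType.Exports.

Local Open Scope classical_set_scope.
Local Open Scope ring_scope.

(** * Nonnegative sums: finite parts and tails *)

Section esum_complements.
Variables (R : realType) (T : choiceType).
Implicit Types (f g : T -> \bar R) (F : {fset T}).
Local Open Scope ereal_scope.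

Lemma le_sum_esum f F : (forall w, 0 <= f w) ->
  \sum_(w <- F) f w <= \esum_(w in [set: T]) f w.
Proof.
move=> f0; apply: esum_ge; exists [set` F]; first by split.
by rewrite fsbig_finite// set_fsetK.
Qed.

Lemma esum_le_sum f a : (forall F, \sum_(w <- F) f w <= a) ->
  \esum_(w in [set: T]) f w <= a.
Proof.
move=> fa; apply: ge_ereal_sup => _ /= [X [finX _]] <-.
by rewrite fsbig_finite//.
Qed.

Lemma esumZ_le (c : R) f : (0 <= c)%R -> (forall w, 0 <= f w) ->
  \esum_(w in [set: T]) (c%:E * f w) <= c%:E * \esum_(w in [set: T]) f w.
Proof.
move=> c0 f0; apply: esum_le_sum => F.
by rewrite -ge0_sume_distrr// lee_wpmul2l// le_sum_esum.
Qed.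

(** The tail is written as a truncated family over the whole type, so that tails compare pointwise
    through [le_esum]. *)
Lemma esum_setID_fset f F : (forall w, 0 <= f w) ->
  \esum_(w in [set: T]) f w =
  \sum_(w <- F) f w + \esum_(w in [set: T]) (if w \in F then 0 else f w).
Proof.
move=> f0; rewrite (esumID [set` F])// !setTI; congr (_ + _).
  by rewrite esum_fset// fsbig_finite// set_fsetK.
rewrite esum_mkcond; apply: eq_esum => w _.
by rewrite in_setC mem_setE; case: (w \in F).
Qed.

(** Some finite partial sum comes within [e] of the supremum, and so does every larger one;
    subtracting it from the finite total leaves the tail. *)
Lemma esum_tail_le f (e : R) : (0 < e)%R -> (forall w, 0 <= f w) ->
  \esum_(w in [set: T]) f w < +oo ->
  exists F0, forall F, (F0 `<=` F)%fset ->
    \esum_(w in [set: T]) (if w \in F then 0 else f w) <= e%:E.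
Proof.
move=> e0 f0 foo.
have ffin : \esum_(w in [set: T]) f w \is a fin_num.
  by rewrite ge0_fin_numE// esum_ge0.
have [_ [X [finX _] <-]] := ub_ereal_sup_adherent e0 ffin.
rewrite -/(esum _ _) fsbig_finite//= => sup_lt; exists (fset_set X) => F XF.
have lef : \sum_(w <- fset_set X) f w <= \sum_(w <- F) f w.
  by apply: lee_sum_nneg_subfset => // w; move/fsubsetP: XF; apply.
have Ffin : \sum_(w <- F) f w \is a fin_num.
  rewrite ge0_fin_numE ?sume_ge0//.
  by apply: le_lt_trans foo; exact: le_sum_esum.
have := lt_le_trans sup_lt lef.
rewrite [in X in X -> _](esum_setID_fset F)//.
set r := esum _ _.
rewrite EFinN lteBlDr// lteD2lE//.
exact: ltW.
Qed.

End esum_complements.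

(** * Differences of signed sums *)

Section rsum.
Variables (R : realType) (T : choiceType).
Implicit Types f g : T -> R.

(** Summing the pointwise inequality f^+ + g^- <= f^- + g^+ + |f - g| involves nonnegative families
    only. The four sums of positive and negative parts are finite, so they can then be moved across.
    This estimate takes the place of linearity of [rsum]. *)
Lemma rsumB_le f g :
  (\esum_(w in [set: T]) `|f w|%:E < +oo)%E ->
  (\esum_(w in [set: T]) `|g w|%:E < +oo)%E ->
  ((rsum f - rsum g)%:E <= \esum_(w in [set: T]) `|f w - g w|%:E)%E.
Proof.
move=> foo goo.
have fin (h : T -> R) : (\esum_(w in [set: T]) `|h w|%:E < +oo)%E ->
    (\esum_(w in [set: T]) (EFin \o h)^\+ w)%E \is a fin_num /\
    (\esum_(w in [set: T]) (EFin \o h)^\- w)%E \is a fin_num.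
  move=> hoo; split; (rewrite ge0_fin_numE; last exact: esum_ge0);
    apply: le_lt_trans hoo; apply: le_esum => w _.
    by rewrite funeposE /= -EFin_max lee_fin ge_max normr_ge0 ler_norm.
  by rewrite funenegE /= -EFin_max lee_fin ge_max normr_ge0 -normrN ler_norm.
have [fp fn] := fin _ foo; have [gp gn] := fin _ goo.
rewrite /rsum EFinB !fineK ?fin_numB ?fp ?fn ?gp ?gn//.
have fg : ((\esum_(w in [set: T]) (EFin \o f)^\+ w) +
    (\esum_(w in [set: T]) (EFin \o g)^\- w) <=
    (\esum_(w in [set: T]) (EFin \o f)^\- w) +
    (\esum_(w in [set: T]) (EFin \o g)^\+ w) +
    \esum_(w in [set: T]) `|f w - g w|%:E)%E.
  rewrite -!esumD//; last by move=> w _; rewrite adde_ge0.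
  apply: le_esum => w _.
  rewrite !funeposE !funenegE /= -!EFin_max -!EFinD lee_fin.
  by rewrite !maxEle; have := ler_norm (f w - g w);
    do !case: ifP; lra.
move: fg fp fn gp gn.
case: (esum _ (EFin \o f)^\+)%E => [p| |]// + _.
case: (esum _ (EFin \o f)^\-)%E => [q| |]// + _.
case: (esum _ (EFin \o g)^\+)%E => [p'| |]// + _.
case: (esum _ (EFin \o g)^\-)%E => [q'| |]// + _.
case: (esum _ _) => [r| |]//=; rewrite ?leey// -?EFinN -!EFinD !lee_fin; lra.
Qed.

End rsum.

(** * The l^1 norm and matrices with bounded columns *)

Section l1norm.
Variables (R : realType) (T : choiceType).
Implicit Types (X Y Z : T -> R) (A B : T -> T -> R).
Local Open Scope ereal_scope.

Lemma l1norm_ge0 X : 0 <= l1norm X.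
Proof. by apply: esum_ge0 => w _; rewrite lee_fin. Qed.

Lemma ler_l1norm X w : `|X w|%:E <= l1norm X.
Proof.
rewrite /l1norm; have := @le_sum_esum R T (fun w => `|X w|%:E) [fset w]%fset.
by rewrite big_seq_fset1; apply => v; rewrite lee_fin.
Qed.

Lemma le_l1norm X Y : (forall w, `|X w| <= `|Y w|)%R -> l1norm X <= l1norm Y.
Proof. by move=> XY; apply: le_esum => w _; rewrite lee_fin. Qed.

Lemma l1norm0 : l1norm (fun _ : T => 0%R : R) = 0 :> \bar R.
Proof. by apply: esum1 => w _; rewrite normr0. Qed.

Lemma l1normN X : l1norm (fun w => - X w)%R = l1norm X.
Proof. by apply: eq_esum => w _; rewrite normrN. Qed.

Lemma l1norm_distC X Y : l1norm (X \- Y)%R = l1norm (Y \- X)%R.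
Proof. by apply: eq_esum => w _ /=; rewrite distrC. Qed.

Lemma l1normD_le X Y : l1norm (fun w => X w + Y w)%R <= l1norm X + l1norm Y.
Proof.
rewrite /l1norm -esumD//.
by apply: le_esum => w _; rewrite lee_fin ler_normD.
Qed.

Lemma l1normB_trans X Y Z :
  l1norm (X \- Z)%R <= l1norm (X \- Y)%R + l1norm (Y \- Z)%R.
Proof.
apply: le_trans (l1normD_le _ _); apply: le_l1norm => w /=.
by rewrite addrA subrK.
Qed.

Lemma l1norm_near X Z (m x : R) : l1norm X <= m%:E ->
  l1norm (X \- Z)%R <= x%:E -> l1norm Z <= (m + x)%:E.
Proof.
move=> Xm XZx; rewrite EFinD; apply: le_trans (leeD Xm XZx).
rewrite -[l1norm (X \- Z)%R]l1normN; apply: le_trans (l1normD_le _ _).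
by apply: le_l1norm => w /=; rewrite opprB addrC subrK.
Qed.

Lemma l1normZ_le (a : R) X :
  l1norm (fun w => a * X w)%R <= `|a|%:E * l1norm X.
Proof.
apply: le_trans (esumZ_le _ _) => //.
by apply: le_esum => w _; rewrite -EFinM normrM.
Qed.

Lemma l1norm_sum_le (I : Type) (r : seq I) (u : I -> T -> R) (v : I -> R) :
  (forall k, l1norm (u k) <= (v k)%:E) ->
  l1norm (fun w => \sum_(k <- r) u k w)%R <= (\sum_(k <- r) v k)%:E.
Proof.
move=> uv; elim: r => [|k r IH].
  by rewrite big_nil; under eq_fun do rewrite big_nil; rewrite l1norm0.
rewrite big_cons; under eq_fun do rewrite big_cons.
by apply: le_trans (l1normD_le _ _) _; rewrite EFinD leeD.
Qed.

(** The supremum of the column norms is the operator norm on l^1, the columns being the images of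
    the unit vectors. *)
Definition col_le A (c : R) := forall j, l1norm (A^~ j) <= c%:E.

Lemma rsum0 : rsum (fun _ : T => 0%R : R) = 0%R :> R.
Proof.
rewrite /rsum !esum1 ?subee// => w _.
  by rewrite funenegE /= oppr0 maxxx.
by rewrite funeposE /= maxxx.
Qed.

(** Supplies the summability that [rsumB_le] asks for: each entry of [A] is at most |c|, so row [i]
    of the product is dominated by |c| |X|. *)
Lemma col_le_summable A X c m i : col_le A c -> l1norm X <= m%:E ->
  \esum_(j in [set: T]) `|A i j * X j|%:E < +oo.
Proof.
move=> Ac Xm.
have Aic j : (`|A i j| <= `|c|)%R.
  rewrite -lee_fin (le_trans (ler_l1norm (A^~ j) i))// (le_trans (Ac j))//.
  by rewrite lee_fin ler_norm.
apply: (@le_lt_trans _ _ (`|c|%:E * m%:E)); last by rewrite -EFinM ltry.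
apply: le_trans (lee_wpmul2l _ Xm); last by rewrite lee_fin.
apply: le_trans (esumZ_le _ _) => //.
by apply: le_esum => w _; rewrite -EFinM normrM lee_fin ler_wpM2r.
Qed.

(** One telescoping step, AX - BZ = (A - B)X + B(X - Z), carried out on absolute values of entries;
    [e i j] is the resulting majorant. *)
Lemma l1norm_mulmxvB A B X Z (c d m x : R) : (0 <= c)%R -> (0 <= d)%R ->
  col_le A c -> col_le B c -> col_le (fun i j => A i j - B i j)%R d ->
  l1norm X <= m%:E -> l1norm (X \- Z)%R <= x%:E ->
  l1norm (mulmxv A X \- mulmxv B Z)%R <= (d * m + c * x)%:E.
Proof.
move=> c0 d0 Ac Bc ABd Xm XZx.
have Zm := l1norm_near Xm XZx.
pose e i j := ((`|A i j - B i j| * `|X j|)%:E + (`|B i j| * `|X j - Z j|)%:E).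
have e0 i j : 0 <= e i j by rewrite adde_ge0// lee_fin mulr_ge0.
have AXBZ i : `|mulmxv A X i - mulmxv B Z i|%:E <= \esum_(j in [set: T]) e i j.
  have AX := col_le_summable i Ac Xm; have BZ := col_le_summable i Bc Zm.
  have le_e j : (`|A i j * X j - B i j * Z j|%:E <= e i j).
    rewrite /e -EFinD -!normrM lee_fin; apply: le_trans (ler_normD _ _).
    by rewrite mulrBl mulrBr addrA subrK.
  (* [rsumB_le] is one-sided, hence one application for each sign of the difference. *)
  rewrite /mulmxv; have [_|_] := ger0P (_ : R).
    apply: le_trans (rsumB_le AX BZ) _.
    by apply: le_esum => j _.
  rewrite opprB; apply: le_trans (rsumB_le BZ AX) _.
  by apply: le_esum => j _; rewrite distrC.
(* Summing over finitely many rows at a time, [esum_sum] exchanges the two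
   summations without a Fubini theorem. *)
apply: esum_le_sum => F.
apply: (@le_trans _ _ (\sum_(i <- F) \esum_(j in [set: T]) e i j)).
  by apply: lee_sum => i _; exact: AXBZ.
rewrite -esum_sum//.
apply: (@le_trans _ _ (\esum_(j in [set: T])
    (d%:E * `|X j|%:E + c%:E * `|X j - Z j|%:E))).
  apply: le_esum => j _; rewrite /e big_split /= !sumEFin -!mulr_suml -EFinM.
  rewrite !EFinM; apply: leeD; apply: lee_wpmul2r => //; rewrite -sumEFin.
    exact: le_trans (le_sum_esum _ _) (ABd j).
  exact: le_trans (le_sum_esum _ _) (Bc j).
rewrite esumD; last 2 first.
- by move=> j _; rewrite -EFinM lee_fin mulr_ge0.
- by move=> j _; rewrite -EFinM lee_fin mulr_ge0.
rewrite EFinD 2!EFinM; apply: leeD.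
  by apply: le_trans (esumZ_le _ _) _ => //; rewrite lee_wpmul2l.
by apply: le_trans (esumZ_le _ _) _ => //; rewrite lee_wpmul2l.
Qed.

(** The case B = A, Z = 0, d = 0, x = m of [l1norm_mulmxvB]. *)
Lemma l1norm_mulmxv A X (c m : R) : (0 <= c)%R ->
  col_le A c -> l1norm X <= m%:E -> l1norm (mulmxv A X) <= (c * m)%:E.
Proof.
move=> c0 Ac Xm.
have A0 : mulmxv A (fun=> 0%R) = (fun=> 0%R).
  apply/funext => i; rewrite -[RHS]rsum0; congr rsum.
  by apply/funext => j; rewrite mulr0.
have := @l1norm_mulmxvB A A X (fun=> 0%R) c 0 m m c0 (lexx _) Ac Ac.
rewrite A0 mul0r add0r.
have sub0 Y : (Y \- (fun=> 0)%R)%R = Y by apply/funext => w /=; rewrite subr0.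
rewrite !sub0; apply => // j.
under eq_fun do rewrite subrr.
by rewrite l1norm0.
Qed.

End l1norm.

(** * Convergence and perturbation of the exponential series *)

Section exponential.
Variables (R : realType) (T : choiceType).
Implicit Types (X Y Z : T -> R) (A B : T -> T -> R).

Lemma l1norm_iter_mulmxv A X (c m : R) k : 0 <= c ->
  col_le A c -> (l1norm X <= m%:E)%E ->
  (l1norm (iter k (mulmxv A) X) <= (c ^+ k * m)%:E)%E.
Proof.
move=> c0 Ac Xm; elim: k => [|k IH]; first by rewrite expr0 mul1r.
by rewrite exprS -mulrA; exact: l1norm_mulmxv.
Qed.

(* The bound [c^k x + k c^(k-1) d m] given by the induction is weakened to a
   single geometric sequence. *)
Lemma l1norm_iter_mulmxvB A B X Z (c d m x : R) k : 1 <= c -> 0 <= d ->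
  col_le A c -> col_le B c -> col_le (fun i j => A i j - B i j) d ->
  (l1norm X <= m%:E)%E -> (l1norm (X \- Z)%R <= x%:E)%E ->
  (l1norm (iter k (mulmxv A) X \- iter k (mulmxv B) Z)%R
    <= ((2 * c) ^+ k * (d * m + x))%:E)%E.
Proof.
move=> c1 d0 Ac Bc ABd Xm XZx.
have c0 : 0 <= c by exact: le_trans c1.
have m0 : 0 <= m by rewrite -lee_fin (le_trans (l1norm_ge0 _) Xm).
have x0 : 0 <= x by rewrite -lee_fin (le_trans (l1norm_ge0 _) XZx).
elim: k => [|k IH].
  by apply: le_trans XZx _; rewrite lee_fin expr0 mul1r lerDr mulr_ge0.
have := l1norm_mulmxvB c0 d0 Ac Bc ABd (l1norm_iter_mulmxv k c0 Ac Xm) IH.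
move=> /le_trans; apply; rewrite lee_fin.
have ck : c ^+ k <= (2 * c) ^+ k.
  by apply: lerXn2r; rewrite ?nnegrE ?mulr_ge0// ler_peMl// ler1n.
have dm0 : 0 <= d * m by exact: mulr_ge0.
have -> : d * (c ^+ k * m) = c ^+ k * (d * m) by rewrite mulrCA.
have h1 : c ^+ k * (d * m) <= (2 * c) ^+ k * (d * m + x).
  by apply: ler_pM => //; rewrite ?exprn_ge0// lerDl.
(* Since [1 <= c], both summands of the goal are at most c (2c)^k (dm + x), and together they give
   the next factor 2c. *)
have h2 : (2 * c) ^+ k * (d * m + x) <= c * ((2 * c) ^+ k * (d * m + x)).
  by rewrite ler_peMl// mulr_ge0 ?addr_ge0// exprn_ge0// mulr_ge0.
rewrite exprS -!mulrA; lra.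
Qed.

(** The Weierstrass test in l^1: domination by [v] gives a limit at each index, and the l^1 distance
    to this pointwise limit is at most the tail of [series v]. *)
Lemma l1_normal_cvg (u : nat -> T -> R) (v : nat -> R) :
  (forall k, l1norm (u k) <= (v k)%:E)%E -> cvgn (series v) ->
  exists Y, l1norm ((fun w => \sum_(0 <= k < n) u k w) \- Y)%R @[n --> \oo]
    --> (0 : \bar R)%E.
Proof.
move=> uv cv.
have v0 k : 0 <= v k by rewrite -lee_fin (le_trans (l1norm_ge0 _) (uv k)).
have cu w : cvgn (series (u^~ w)).
  apply: normed_cvg; apply: series_le_cvg cv => //= k.
  by rewrite -lee_fin (le_trans (ler_l1norm _ _) (uv k)).
pose Y w := limn (series (u^~ w)); exists Y.
have tail n : (l1norm ((fun w => \sum_(0 <= k < n) u k w) \- Y)%R <=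
    (limn (series v) - series v n)%:E)%E.
  apply: esum_le_sum => F; rewrite sumEFin lee_fin.
  (* Over a finite [F] the limit in [N] commutes with the sum; the bound obtained is uniform in [F],
     so it passes to the full norm. *)
  have cF : \sum_(w <- F) `|series (u^~ w) n - series (u^~ w) N| @[N --> \oo] -->
      \sum_(w <- F) `|series (u^~ w) n - Y w|.
    apply: cvg_big => [|w _]; first exact: add_continuous.
    by apply: cvg_norm; apply: cvgB; [exact: cvg_cst|exact: cu].
  rewrite -(cvg_lim _ cF)//; apply: limr_le; first by apply/cvg_ex; eexists; exact: cF.
  near=> N.
  have nN : (n <= N)%N by near: N; exact: nbhs_infty_ge.
  rewrite -lee_fin -sumEFin; apply: le_trans (le_sum_esum _ _) _ => //.
  apply: (@le_trans _ _ (\sum_(n <= k < N) v k)%:E).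
    apply: le_trans (l1norm_sum_le _ uv); apply: le_l1norm => w /=.
    by rewrite distrC sub_series_geq.
  rewrite lee_fin -sub_series_geq// lerD2r.
  apply: nondecreasing_cvgn_le => //; exact: nondecreasing_series.
apply: (@squeeze_cvge _ _ _ _ (cst 0%E) _
  (fun n => (limn (series v) - series v n)%:E)).
- by apply: nearW => n; rewrite /cst l1norm_ge0 tail.
- exact: cvg_cst.
- apply: cvg_EFin; first by near=> n.
  have -> : 0 = limn (series v) - limn (series v) by rewrite subrr.
  by apply: cvgB; [exact: cvg_cst|exact: cv].
Unshelve. all: end_near.
Qed.

Definition exp_partial A X n w :=
  \sum_(0 <= k < n) k`!%:R^-1 * iter k (mulmxv A) X w.

(** The terms are dominated by m c^k / k!, so an l^1 limit exists and [get] in [l1lim] returns a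
    genuine limit, not its default value. *)
Lemma expmxv_cvg A X (c m : R) : 0 <= c -> col_le A c ->
  (l1norm X <= m%:E)%E ->
  l1norm (exp_partial A X n \- expmxv A X)%R @[n --> \oo] --> (0 : \bar R)%E.
Proof.
move=> c0 Ac Xm.
have [||Y hY] := @l1_normal_cvg
  (fun k w => k`!%:R^-1 * iter k (mulmxv A) X w) (m *: exp_coeff c).
- move=> k; apply: le_trans (l1normZ_le _ _) _.
  have -> : (m *: exp_coeff c) k = k`!%:R^-1 * (c ^+ k * m).
    by rewrite mulrA mulrC [_^-1 * _]mulrC.
  rewrite ger0_norm ?invr_ge0// EFinM.
  by rewrite lee_wpmul2l ?lee_fin ?invr_ge0// l1norm_iter_mulmxv.
- exact/is_cvg_seriesZ/is_cvg_series_exp_coeff.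
exact: (@getPex _ [set Y | _] (ex_intro _ Y hY)).
Qed.

Lemma l1norm_expmxvB A B X Z (c d m x : R) : 1 <= c -> 0 <= d ->
  col_le A c -> col_le B c -> col_le (fun i j => A i j - B i j) d ->
  (l1norm X <= m%:E)%E -> (l1norm (X \- Z)%R <= x%:E)%E ->
  (l1norm (expmxv A X \- expmxv B Z)%R <= (expR (2 * c) * (d * m + x))%:E)%E.
Proof.
move=> c1 d0 Ac Bc ABd Xm XZx.
have c0 : 0 <= c by exact: le_trans c1.
have E0 : 0 <= d * m + x.
  rewrite addr_ge0 ?mulr_ge0//; rewrite -lee_fin.
    exact: le_trans (l1norm_ge0 _) Xm.
  exact: le_trans (l1norm_ge0 _) XZx.
have Zm := l1norm_near Xm XZx.
have partial n : (l1norm (exp_partial A X n \- exp_partial B Z n)%R <=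
    (expR (2 * c) * (d * m + x))%:E)%E.
  have le_term k : (l1norm (fun w => k`!%:R^-1 *
      (iter k (mulmxv A) X \- iter k (mulmxv B) Z) w)%R <=
      (exp_coeff (2 * c) k * (d * m + x))%:E)%E.
    apply: le_trans (l1normZ_le _ _) _.
    have -> : exp_coeff (2 * c) k * (d * m + x) =
        k`!%:R^-1 * ((2 * c) ^+ k * (d * m + x)).
      by rewrite mulrA [_^-1 * _]mulrC.
    rewrite ger0_norm ?invr_ge0// EFinM.
    by rewrite lee_wpmul2l ?lee_fin ?invr_ge0//; exact: l1norm_iter_mulmxvB.
  have := l1norm_sum_le (index_iota 0 n) le_term.
  rewrite -mulr_suml => h; apply: le_trans (le_trans h _).
    apply: le_l1norm => w; rewrite /exp_partial /= -sumrB.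
    rewrite le_eqVlt; apply/orP; left; apply/eqP; congr (`|_|).
    by apply: eq_bigr => k _; rewrite mulrBr.
  (* [expR] is the limit of the series of [exp_coeff], whose partial sums are nondecreasing. *)
  rewrite lee_fin ler_wpM2r//; apply: nondecreasing_cvgn_le; last first.
    exact: is_cvg_series_exp_coeff.
  by apply: nondecreasing_series => k _ _; rewrite exp_coeff_ge0// mulr_ge0.
(* The bound passes to the limits by the triangle inequality, with an error of [e / 2] for each of
   the two exponentials. *)
apply/lee_addgt0Pr => e e0.
have e2 : (0 < (e / 2)%:E)%E by rewrite lte_fin divr_gt0.
have [N1 _ hA] := expmxv_cvg c0 Ac Xm (open_ereal_lt' e2).
have [N2 _ hB] := expmxv_cvg c0 Bc Zm (open_ereal_lt' e2).
pose n := maxn N1 N2.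
have An := ltW (hA n (leq_maxl N1 N2)); have Bn := ltW (hB n (leq_maxr N1 N2)).
apply: le_trans (l1normB_trans _ (exp_partial A X n) _) _.
rewrite l1norm_distC.
apply: le_trans (leeD (An) (l1normB_trans _ (exp_partial B Z n) _)) _.
apply: le_trans (leeD (lexx _) (leeD (partial n) (Bn))) _.
rewrite -!EFinD lee_fin; lra.
Qed.

End exponential.

(** * Approximation of the generator and of the initial vector *)

Section finite_subsystems.
Variables (R : realType) (T : choiceType).
Implicit Types (gamma : T -> T -> R) (P : T -> R) (F : {fset T}).

(** A finite part [F] of column [j] is the finite set of pairs F x {j}, whose sum [norm11 A]
    bounds. *)
Lemma norm11_col_le (A : T -> T -> R) : (norm11 A < +oo)%E ->
  col_le A (fine (norm11 A)).
Proof.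
move=> Aoo j; rewrite fineK; last by rewrite ge0_fin_numE// esum_ge0.
apply: esum_le_sum => F.
have := @le_sum_esum R _ (fun ij => `|A ij.1 ij.2|%:E) (F `*` [fset j])%fset.
move=> /(_ (fun=> normr_ge0 _)); apply: le_trans.
rewrite (_ : (F `*` [fset j])%fset = [fset (i, j) | i in F]%fset); last first.
  apply/fsetP => -[i k]; rewrite in_fsetM /= in_fset1.
  apply/andP/imfsetP => /= [[iF /eqP ->]|[i' i'F [-> ->]]]; first by exists i.
  by rewrite i'F eqxx.
by rewrite big_imfset//= => i i' _ _ [].
Qed.

(** A finite set of pairs carries all but [e] of the mass, and it lies in F x F once [F] contains
    both of its projections. Each column of the truncated matrix is then bounded by the total
    remaining mass. *)
Lemma norm11_tail (A : T -> T -> R) (e : R) : 0 < e -> (norm11 A < +oo)%E ->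
  exists F0, forall F, (F0 `<=` F)%fset ->
    col_le (fun i j => if (i \in F) && (j \in F) then 0 else A i j) e.
Proof.
move=> e0 Aoo.
have [//|G0 hG] := esum_tail_le e0 _ Aoo.
exists ([fset p.1 | p in G0] `|` [fset p.2 | p in G0])%fset => F.
rewrite fsubUset => /andP[/fsubsetP sub1 /fsubsetP sub2] j.
have G0F : (G0 `<=` F `*` F)%fset.
  apply/fsubsetP => p pG0; rewrite in_fsetM sub1 ?sub2//; apply/imfsetP;
  by exists p.
pose B i j := if (i \in F) && (j \in F) then 0 else A i j.
have Be : (norm11 B <= e%:E)%E.
  apply: le_trans (hG _ G0F); apply: le_esum => -[i k] _ /=.
  by rewrite in_fsetM /B /=; case: ifP; rewrite ?normr0.
have Boo := le_lt_trans Be (ltry e).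
apply: le_trans (norm11_col_le Boo j) _.
by rewrite fineK// ge0_fin_numE// esum_ge0.
Qed.

(** On the diagonal, the exit rate into [F] is part of the full exit rate, whose finiteness rules
    out the default value 0 of [fine]. *)
Lemma generator_onE_le gamma F i j : (forall i j, 0 <= gamma i j) ->
  (\esum_(k in [set: T]) (gamma j k)%:E < +oo)%E ->
  `|generator_on gamma F i j| <= `|generator gamma i j|.
Proof.
move=> g0 joo; rewrite /generator_on /generator.
case: ifP => [|_]; last by rewrite normr0.
have gj0 k : (0 <= (gamma j k)%:E)%E by rewrite lee_fin.
have E0 : (0 <= \esum_(k in [set: T]) (gamma j k)%:E)%E by exact: esum_ge0.
case: eqP => // _ _; rewrite !normrN !ger0_norm ?fine_ge0 ?sumr_ge0//.
rewrite -lee_fin fineK ?ge0_fin_numE//.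
by rewrite -sumEFin le_sum_esum.
Qed.

(** The rates out of [j] are the off-diagonal entries of column [j]; as [gamma j j] is 0, the
    comparison holds whatever value [fine] puts on the diagonal. *)
Lemma exit_rate_lty gamma j : (forall i j, 0 <= gamma i j) ->
  (forall i, gamma i i = 0) -> (norm11 (generator gamma) < +oo)%E ->
  (\esum_(k in [set: T]) (gamma j k)%:E < +oo)%E.
Proof.
move=> g0 gd Goo; apply: le_lt_trans (ltry (fine (norm11 (generator gamma)))).
apply: le_trans (norm11_col_le Goo j); apply: le_esum => k _ /=.
rewrite lee_fin /generator; case: eqP => [->|_]; first by rewrite gd.
by rewrite ler_norm.
Qed.

Lemma generator_on_approx gamma (e : R) F : (forall i j, 0 <= gamma i j) ->
  (forall i, gamma i i = 0) -> (norm11 (generator gamma) < +oo)%E ->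
  col_le (fun i j => if (i \in F) && (j \in F) then 0 else generator gamma i j) e ->
  col_le (fun i j => generator gamma i j - generator_on gamma F i j) (2 * e).
Proof.
move=> g0 gd Goo He j.
have e0 : 0 <= e by rewrite -lee_fin (le_trans (l1norm_ge0 _) (He j)).
have joo := exit_rate_lty j g0 gd Goo.
have gj0 k : (0 <= (gamma j k)%:E)%E by rewrite lee_fin.
have E0 : (0 <= \esum_(k in [set: T]) (gamma j k)%:E)%E by exact: esum_ge0.
pose D := (\esum_(k in [set: T]) (if k \in F then 0 else (gamma j k)%:E))%E.
(* For [j] outside [F], column [j] of [generator_on] vanishes and the difference is the truncated
   column itself. *)
have [jF|jF] := boolP (j \in F); last first.
  apply: (@le_trans _ _ e%:E); last by rewrite lee_fin ler_peMl// ler1n.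
  apply: le_trans (He j); apply: le_l1norm => i.
  by rewrite /generator_on (negPf jF) andbF subr0.
(* [D] is the exit rate missing on the diagonal; its terms are entries of column [j] in rows outside
   [F]. *)
have De : (D <= e%:E)%E.
  apply: le_trans (He j); apply: le_esum => k _; rewrite jF andbT.
  case: ifPn => [_|kF]; first by rewrite normr0.
  rewrite /generator; case: eqP => [kj|_]; first by rewrite kj jF in kF.
  by rewrite lee_fin ler_norm.
have diag : `|generator gamma j j - generator_on gamma F j j| <= e.
  rewrite /generator /generator_on eqxx jF /= opprK addrC distrC ger0_norm.
    rewrite -lee_fin; apply: le_trans De.
    rewrite EFinB fineK ?ge0_fin_numE//.
    rewrite (esum_setID_fset F)// -sumEFin addeAC subee ?add0e//.
    by rewrite sumEFin.
  rewrite subr_ge0 -lee_fin fineK ?ge0_fin_numE//.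
  by rewrite -sumEFin le_sum_esum.
rewrite mulr2n mulrDl mul1r EFinD.
(* The column of the difference is dominated by the truncated column [q] plus a spike [dl] of height
   [e] in row [j]. *)
pose q i := if (i \in F) && (j \in F) then 0 else generator gamma i j.
pose dl i := if i == j then e else 0.
apply: (@le_trans _ _ (l1norm (fun i => q i + dl i))).
  apply: le_l1norm => i; rewrite /q /dl jF andbT.
  have [->|ij] := eqVneq i j; first by rewrite jF add0r (ger0_norm e0).
  rewrite addr0 /generator_on jF andbT (negPf ij).
  by case: ifP => iF; rewrite ?subr0// /generator (negPf ij) subrr.
apply: le_trans (l1normD_le _ _) _; apply: leeD; first exact: He.
rewrite /l1norm (esum_setID_fset [fset j]%fset)// big_seq_fset1.
rewrite /dl eqxx ger0_norm// esum1 ?adde0// => i _.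
by rewrite in_fset1; case: ifP => // ->; rewrite normr0.
Qed.

Lemma probability_vector_weight P F (e : R) : probability_vector P ->
  (\esum_(w in [set: T]) (if w \in F then 0 else `|P w|%:E) <= e%:E)%E ->
  weight P F <= 1 <= weight P F + e.
Proof.
move=> [P0 P1] Pe.
have PF : \sum_(w <- F) `|P w| = weight P F.
  by apply: eq_bigr => w _; rewrite ger0_norm.
rewrite -!lee_fin EFinD -P1 /l1norm -PF -sumEFin; apply/andP; split.
  exact: le_sum_esum.
by rewrite (esum_setID_fset F)// leeD2l.
Qed.

(** On [F], division by a weight at most 1 does not decrease entries, so the differences there sum
    to exactly 1 - [weight P F]; outside [F] the difference is [P]. Each part is at most [e]. *)
Lemma restrict_vector_approx P F (e : R) : probability_vector P ->
  0 < weight P F ->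
  (\esum_(w in [set: T]) (if w \in F then 0 else `|P w|%:E) <= e%:E)%E ->
  (l1norm (P \- restrict_vector P F)%R <= (2 * e)%:E)%E.
Proof.
move=> PP p0 Pe; have /andP[p1 pe] := probability_vector_weight PP Pe.
have [P0 _] := PP.
rewrite /l1norm (esum_setID_fset F)// mulr2n mulrDl mul1r EFinD.
apply: leeD; last first.
  apply: le_trans Pe; apply: le_esum => w _; case: ifPn => // wF.
  by rewrite /= /restrict_vector (negPf wF) subr0.
rewrite sumEFin lee_fin.
have -> : \sum_(w <- F) `|(P \- restrict_vector P F) w| = 1 - weight P F.
  transitivity (\sum_(w <- F) P w * ((weight P F)^-1 - 1)).
    rewrite big_seq [RHS]big_seq; apply: eq_bigr => w wF.
    rewrite /= /restrict_vector wF distrC mulrBr mulr1 ger0_norm//.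
    by rewrite subr_ge0 ler_peMr// invf_ge1.
  by rewrite -mulr_suml mulrBr mulr1 divff// gt_eqF.
by rewrite lerBlDl.
Qed.

End finite_subsystems.

(** * The thermodynamic limit: choice of constants and conclusion *)

Theorem theorem9 (R : realType) (Omega : choiceType)
  (Omega_countably_infinite : ([set: Omega] #= [set: nat])%card)
  (gamma : Omega -> Omega -> R)
  (gamma_ge0 : forall i j, 0 <= gamma i j)
  (gamma_diag : forall i, gamma i i = 0)
  (Gamma_norm : (norm11 (generator gamma) < +oo)%E)
  (P0 : Omega -> R) (P0_prob : probability_vector P0)
  (t : R) (t_gt0 : 0 < t) :
  forall eps : R, 0 < eps ->
  exists Feps : {fset Omega}, forall F : {fset Omega},
    (Feps `<=` F)%fset ->
    0 < weight P0 F /\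
    (l1norm (solution gamma t P0 \- solution_on gamma F t P0)%R < eps%:E)%E.

Proof.
move=> eps eps0.
set G := generator gamma in Gamma_norm *.
have G0 : 0 <= fine (norm11 G) by rewrite fine_ge0// esum_ge0.
have Gcol := norm11_col_le Gamma_norm.
(* A column bound common to both scaled generators; the summand 1 secures [1 <= c]. *)
pose c := 1 + t * fine (norm11 G).
have c1 : 1 <= c by rewrite lerDl mulr_ge0// ltW.
pose K := 1 + `|expR (2 * c)|.
have K0 : 0 < K by rewrite ltr_pwDl.
(* The value 1/2 forces [weight P0 F] to be at least 1/2. The other value makes the final bound 2 K
   e (t + 1) at most [eps / 2], which gives the strict inequality. *)
pose e := Num.min 2^-1 (eps / (4 * K * (t + 1))).
have den0 : 0 < 4 * K * (t + 1) by rewrite !mulr_gt0// addr_gt0.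
have e0 : 0 < e by rewrite lt_min invr_gt0 ltr0n divr_gt0.
have e_half : e <= 2^-1 by rewrite ge_min lexx.
have e_eps : e * (4 * K * (t + 1)) <= eps.
  by rewrite -ler_pdivlMr// ge_min lexx orbT.
have P0_le : (l1norm P0 <= 1%:E)%E by have [_ ->] := P0_prob.
have P0_lty : (\esum_(w in [set: Omega]) `|P0 w|%:E < +oo)%E.
  exact: le_lt_trans P0_le (ltry _).
have [F1 hF1] := norm11_tail e0 Gamma_norm.
have [//|F2 hF2] := esum_tail_le e0 _ P0_lty.
exists (F1 `|` F2)%fset => F; rewrite fsubUset => /andP[F1F F2F].
have P0_tail := hF2 F F2F.
have /andP[p1 pe] := probability_vector_weight P0_prob P0_tail.
have p0 : 0 < weight P0 F by lra.
split=> //.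
have GF := generator_on_approx gamma_ge0 gamma_diag Gamma_norm (hF1 F F1F).
have scale (A : Omega -> Omega -> R) a : col_le A a -> col_le (fun i j => t * A i j) (t * a).
  move=> Aa j; apply: le_trans (l1normZ_le _ _) _.
  by rewrite (gtr0_norm t_gt0) EFinM lee_wpmul2l// lee_fin ltW.
have GFcol : col_le (generator_on gamma F) (fine (norm11 G)).
  move=> j; apply: le_trans (Gcol j); apply: le_l1norm => i.
  by apply: generator_onE_le => //; exact: exit_rate_lty.
have widen (A : Omega -> Omega -> R) : col_le A (fine (norm11 G)) -> col_le (fun i j => t * A i j) c.
  move=> /scale Aa j; apply: le_trans (Aa j) _.
  by rewrite lee_fin lerDr.
have diff : col_le (fun i j => t * G i j - t * generator_on gamma F i j)
    (t * (2 * e)).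
  move=> j; under eq_fun do rewrite -mulrBr; exact: scale GF j.
have d0 : 0 <= t * (2 * e) by rewrite !mulr_ge0// ltW.
have := l1norm_expmxvB c1 d0 (widen _ Gcol) (widen _ GFcol) diff
  P0_le (restrict_vector_approx P0_prob p0 P0_tail).
move=> /le_lt_trans; apply; rewrite lte_fin.
have -> : t * (2 * e) * 1 + 2 * e = 2 * (e * (t + 1)) by ring.
have te0 : 0 < e * (t + 1) by rewrite mulr_gt0// addr_gt0.
have : expR (2 * c) * (2 * (e * (t + 1))) <= K * (2 * (e * (t + 1))).
  apply: ler_wpM2r; first by rewrite mulr_ge0// ltW.
  by rewrite (le_trans (ler_norm _))// lerDr.
have -> : K * (2 * (e * (t + 1))) = e * (4 * K * (t + 1)) / 2 by field.
lra.
Qed.
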